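(* Let $p$ be a prime and let $e\geq 2$ and $d\geq 2$ be integers. Let $\mathcal P(p^e,d)\subset\mathbb R^d$ be the convex hull of all $d$-dimensional vector-factorisations of $p^e$, and for $0\le k\le d$ let $f_k$ be the number of $k$-dimensional faces of $\mathcal P(p^e,d)$. Then $$f_0={e+d-1\choose d-1},\qquad f_1={d\choose 2}+{d\choose 2}{e+d-2\choose d-1},$$ $$f_k={d+1\choose k+1}+{d\choose k+1}{e+d-1\choose d}-{d\choose k+1}{e-k+d-1\choose d}\quad\text{for }2\leq k<d,$$ $$f_d=1.$$
   Context: $\mathbb N=\{0,1,2,\dots\}$. A $d$-dimensional vector-factorisation of an integer $N\geq1$ is an integral vector $(v_1,\dots,v_d)\in\mathbb N^d$ with $v_1v_2\cdots v_d=N$. *)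

(* Defs.v *)
From HB Require Import structures.
From mathcomp Require Import all_boot all_order all_algebra.
From mathcomp Require Import reals.
Set Implicit Arguments. Unset Strict Implicit. Unset Printing Implicit Defensive.
Import Order.TTheory GRing.Theory Num.Theory.
Local Open Scope ring_scope.

Definition vfact (R : realType) (N d : nat) (x : 'rV[R]_d) : Prop :=
  exists v : 'I_d -> nat, (\prod_(i < d) v i)%N = N /\ forall i, x 0 i = (v i)%:R.

Definition conv_hull (R : realType) (d : nat) (A : 'rV[R]_d -> Prop)
  (x : 'rV[R]_d) : Prop :=
  exists (n : nat) (pt : 'I_n -> 'rV[R]_d) (lam : 'I_n -> R),
    (forall i, A (pt i)) /\ (forall i, 0 <= lam i) /\
    \sum_(i < n) lam i = 1 /\ x = \sum_(i < n) lam i *: pt i.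

Definition dotv (R : realType) (d : nat) (c x : 'rV[R]_d) : R :=
  \sum_(i < d) c 0 i * x 0 i.

(* F is a (nonempty) face of P: the intersection of P with a supporting
   hyperplane {c.x = m} where c.x <= m on P (c = 0, m = 0 gives P itself). *)
Definition is_face (R : realType) (d : nat) (P F : 'rV[R]_d -> Prop) : Prop :=
  (exists x, F x) /\
  exists (c : 'rV[R]_d) (m : R),
    (forall x, P x -> dotv c x <= m) /\
    (forall x, F x <-> (P x /\ dotv c x = m)).

Definition diff_mx (R : realType) (d n : nat) (x : 'I_n.+1 -> 'rV[R]_d)
  : 'M[R]_(n, d) :=
  \matrix_(i < n, j < d) (x (lift ord0 i) 0 j - x ord0 0 j).

Definition affdim (R : realType) (d : nat) (F : 'rV[R]_d -> Prop) (k : nat)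
  : Prop :=
  (exists (n : nat) (x : 'I_n.+1 -> 'rV[R]_d),
      (forall i, F (x i)) /\ \rank (diff_mx x) = k) /\
  (forall (n : nat) (x : 'I_n.+1 -> 'rV[R]_d),
      (forall i, F (x i)) -> (\rank (diff_mx x) <= k)%N).

Definition is_kface (R : realType) (d : nat) (P : 'rV[R]_d -> Prop) (k : nat)
  (F : 'rV[R]_d -> Prop) : Prop :=
  is_face P F /\ affdim F k.

Definition num_faces (R : realType) (d : nat) (P : 'rV[R]_d -> Prop)
  (k n : nat) : Prop :=
  exists f : 'I_n -> ('rV[R]_d -> Prop),
    injective f /\ forall F, is_kface P k F <-> exists i, F = f i.

(* Main.v *)
(* Write a factorisation of p^e as (p^{a_1}, ..., p^{a_d}) with a a composition
   of e. A face of the polytope is the hull of the compositions maximising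
   some sum_j c_j p^{a_j}, and such maximisers are determined by bounding every
   term c_j p^n by one affine function of n with a slope independent of j:
   - if some c_j > 0, chords over [0, e] show that the maximisers are the points
     e.delta_i with c_i maximal: the simplices on the S with |S| = k+1;
   - if c <= 0 has zero set Z <> {}, the maximisers are the compositions supported
     on Z, and the face is a copy of the polytope in dimension |Z|, of
     dimension |Z| itself as soon as |Z| >= 2 (this uses e >= 2);
   - if c < 0, tangents show that the maximisers are the b + 1_T with T a subset
     of S and |T| = e - |b|, where b is any exponent vector: a hypersimplex of
     dimension |S| - 1 when 0 < e - |b| < |S|. *)
Require Import Defs.
From mathcomp Require Import all_boot all_order all_algebra.
From mathcomp Require Import reals boolp.
From mathcomp Require Import zify ring lra.

Set Implicit Arguments. Unset Strict Implicit. Unset Printing Implicit Defensive.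
Import Order.TTheory GRing.Theory Num.Theory.

(** * Faces of the convex hull of finitely many points *)

Section Hull.
Local Open Scope ring_scope.
Variables (R : realType) (d : nat) (I : finType) (g : I -> 'rV[R]_d).
Implicit Types (M X : {set I}) (c x : 'rV[R]_d) (k : nat).

Definition hull M := conv_hull (fun x => exists2 a, a \in M & x = g a).

Definition argmax X c :=
  [set a in X | [forall b in X, dotv c (g b) <= dotv c (g a)]].

(** Grouping the weights of a point list by a chosen index turns it into one weight function on [I]
    supported on [M], so later arguments never handle lists. *)
Lemma hullP M x :
  hull M x <-> exists lam : I -> R, [/\ forall a, 0 <= lam a,
    forall a, a \notin M -> lam a = 0, \sum_a lam a = 1 &
    x = \sum_a lam a *: g a].
Proof.
split=> [[n [pt [mu [ptM [mu_ge0 [mu1 ->]]]]]]|[lam [lam_ge0 lam0 lam1 ->]]].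
  have /choice[f fP] i : exists a, a \in M /\ pt i = g a.
    by have [a aM ->] := ptM i; exists a.
  exists (fun a => \sum_(i | f i == a) mu i); split.
  - by move=> a; apply: sumr_ge0.
  - move=> a aM; apply: big_pred0 => i; apply: contraNF aM => /eqP <-.
    by have [] := fP i.
  - by rewrite -mu1 [RHS](partition_big f predT).
  - rewrite (partition_big f predT) //=; apply: eq_bigr => a _.
    rewrite scaler_suml; apply: eq_bigr => i /eqP <-.
    by have [_ ->] := fP i.
have supp (V : zmodType) (F : I -> V) : (forall a, a \notin M -> F a = 0) ->
    \sum_a F a = \sum_(i < #|M|) F (enum_val i).
  move=> F0; rewrite -big_enum_val /= [RHS]big_mkcond; apply: eq_bigr => a _.
  by case: ifPn => // /F0.
exists #|M|, (g \o enum_val), (lam \o enum_val); do !split => //=.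
- by move=> i; exists (enum_val i); rewrite ?enum_valP.
- by rewrite -supp.
- by apply: supp => a /lam0 ->; rewrite scale0r.
Qed.

Lemma sub_hull M a : a \in M -> hull M (g a).
Proof.
move=> aM; apply/hullP; exists (fun b => (b == a)%:R); split.
- by move=> b; rewrite ler0n.
- by move=> b; case: eqP => // -> /negP.
- by rewrite (bigD1 a) //= eqxx big1 ?addr0 // => b /negPf ->.
- by rewrite (bigD1 a) //= eqxx scale1r big1 ?addr0 // => b /negPf ->;
    rewrite scale0r.
Qed.

Lemma hull_nonempty M x : hull M x -> exists a, a \in M.
Proof.
case/hullP=> lam [_ lam0 lam1 _]; apply/set0Pn; apply: contra_eq_neq lam1.
by move=> M0; rewrite big1 1?eq_sym ?oner_neq0 // => a _; rewrite lam0 ?M0 ?inE.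
Qed.

Lemma dotv_sum c (lam : I -> R) :
  dotv c (\sum_a lam a *: g a) = \sum_a lam a * dotv c (g a).
Proof.
rewrite /dotv; under eq_bigr do rewrite summxE mulr_sumr.
rewrite exchange_big /=; apply: eq_bigr => a _; rewrite mulr_sumr.
by apply: eq_bigr => i _; rewrite mxE mulrCA.
Qed.

(** A weighted mean of values reaches their maximum only if no weight falls on a strictly smaller
    value, that is, only if the weights live on [argmax X c]. *)
Lemma hull_argmaxP X c a x : a \in argmax X c ->
  hull (argmax X c) x <-> hull X x /\ dotv c x = dotv c (g a).
Proof.
move=> aM; set m := dotv c (g a).
have [aX /forall_inP a_max] := setIdP aM.
have eqm b : b \in argmax X c -> dotv c (g b) = m.
  rewrite inE => /andP[bX /forall_inP b_max].
  by apply/eqP; rewrite eq_le a_max ?b_max.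
split=> [|[]] /hullP[lam [lam_ge0 lam0 lam1 ->]].
  split.
    apply/hullP; exists lam; split=> // b bX; apply: lam0.
    by rewrite inE (negPf bX).
  rewrite dotv_sum -[RHS]mul1r -lam1 mulr_suml; apply: eq_bigr => b _.
  by have [/eqm ->|/lam0 ->] := boolP (b \in argmax X c); rewrite ?mul0r.
rewrite dotv_sum => eq_m; apply/hullP; exists lam; split=> // b bM.
have [bX|/lam0 //] := boolP (b \in X).
have lt_m : dotv c (g b) < m.
  rewrite lt_neqAle a_max // andbT; apply: contraNneq bM => eqb.
  by rewrite inE bX; apply/forall_inP=> b' /a_max; rewrite eqb.
have ge0 b' : 0 <= lam b' * (m - dotv c (g b')).
  have [b'X|/lam0 ->] := boolP (b' \in X); last by rewrite mul0r.
  by rewrite mulr_ge0 ?subr_ge0 ?a_max.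
have sum0 : \sum_b lam b * (m - dotv c (g b)) = 0.
  under eq_bigr do rewrite mulrBr.
  by rewrite sumrB -mulr_suml lam1 mul1r eq_m subrr.
have := @psumr_eq0P _ _ xpredT _ (fun b' _ => ge0 b') sum0 b isT.
by move/eqP; rewrite mulf_eq0 subr_eq0 [m == _]eq_sym (lt_eqF lt_m) orbF => /eqP.
Qed.

Lemma hull_dotv_le X c a x : a \in argmax X c -> hull X x ->
  dotv c x <= dotv c (g a).
Proof.
move=> /setIdP[aX /forall_inP a_max] /hullP[lam [lam_ge0 lam0 lam1 ->]].
rewrite dotv_sum -[leRHS]mul1r -lam1 mulr_suml; apply: ler_sum => b _.
have [bX|/lam0 ->] := boolP (b \in X); last by rewrite !mul0r.
by rewrite ler_wpM2l ?a_max.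
Qed.

Lemma argmax_nonempty X c : X != set0 -> exists a, a \in argmax X c.
Proof.
case/set0Pn=> a0 a0X.
case: (arg_maxP (fun a => dotv c (g a)) a0X) => a aX a_max.
by exists a; rewrite inE; apply/andP; split=> //; apply/forall_inP.
Qed.

Lemma is_face_hullP X F : X != set0 ->
  is_face (hull X) F <-> exists c, F = hull (argmax X c).
Proof.
move=> X0; split=> [[[x Fx] [c [m [P_le FP]]]]|[c ->]]; last first.
  have [a aM] := argmax_nonempty c X0; split; first by exists (g a); apply: sub_hull.
  exists c, (dotv c (g a)); split=> [x|x]; first exact: hull_dotv_le.
  exact: hull_argmaxP.
exists c; have [a aM] := argmax_nonempty c X0.
(* A supporting hyperplane that meets the hull sits at the maximum: the face point [x] bounds [m]
   from above, the maximiser [a] from below. *)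
have eq_m : m = dotv c (g a).
  have [aX _] := setIdP aM; have [xX xm] := (FP x).1 Fx.
  apply/eqP; rewrite eq_le -{1}xm (hull_dotv_le aM xX) /=.
  exact/P_le/sub_hull.
by apply/funext => y; apply/propext; rewrite FP eq_m (hull_argmaxP _ aM).
Qed.

(** A maximiser of one form lies in the hull of the maximisers of the other, hence attains the other
    maximum too. So a face determines its generators, and faces can be counted as subsets of [I]. *)
Lemma hull_argmax_inj X c c' :
  hull (argmax X c) = hull (argmax X c') -> argmax X c = argmax X c'.
Proof.
suff sub c1 c2 : hull (argmax X c1) = hull (argmax X c2) ->
    argmax X c1 \subset argmax X c2.
  by move=> eqh; apply/eqP; rewrite eqEsubset !sub.
move=> eqh; apply/subsetP => a aM1; have [aX _] := setIdP aM1.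
have X0 : X != set0 by apply/set0Pn; exists a.
have [b bM2] := argmax_nonempty c2 X0.
have := sub_hull aM1; rewrite eqh => /(hull_argmaxP _ bM2)[_ eqab].
rewrite inE aX; apply/forall_inP => a'; rewrite eqab.
by case/setIdP: bM2 => _ /forall_inP; apply.
Qed.

(** * Affine dimension of hulls and the counting of faces *)

Lemma hull_sub_mx M k (W : 'M[R]_(k, d)) y x : hull M x ->
  (forall a, a \in M -> (g a - y <= W)%MS) -> (x - y <= W)%MS.
Proof.
move=> /hullP[lam [_ lam0 lam1 ->]] MW.
rewrite -[y]scale1r -lam1 scaler_suml -sumrB; apply: summx_sub => a _.
rewrite -scalerBr; have [/MW aW|/lam0 ->] := boolP (a \in M).
  exact: scalemx_sub.
by rewrite scale0r sub0mx.
Qed.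

Lemma row_diff_mx n (x : 'I_n.+1 -> 'rV[R]_d) i :
  row i (diff_mx x) = x (lift ord0 i) - x ord0.
Proof. by apply/rowP=> j; rewrite !mxE. Qed.

(* Dually to exhibiting k+1 affinely independent points, [k]-dimensionality is
   certified by showing that every linear form constant on [M] kills [W]. *)
Lemma affdim_hull M k (W : 'M[R]_(k, d)) a0 : a0 \in M -> row_free W ->
  (forall a, a \in M -> (g a - g a0 <= W)%MS) ->
  (forall c : 'cV_d, (forall a, a \in M -> (g a - g a0) *m c = 0) ->
     W *m c = 0) ->
  affdim (hull M) k.
Proof.
move=> a0M /eqP rkW MW dualW; split.
  (* The list is [a0] followed by all of [M], so its differences from the base point are exactly the
     [g a - g a0]. *)
  pose x (i : 'I_#|M|.+1) : 'rV[R]_d :=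
    if unlift ord0 i is Some j then g (enum_val j) else g a0.
  have xS j : x (lift ord0 j) = g (enum_val j) by rewrite /x liftK.
  have x0 : x ord0 = g a0 by rewrite /x unlift_none.
  exists #|M|, x; split.
    move=> i; rewrite /x; case: unliftP => [j|] _; apply: sub_hull => //.
    exact: enum_valP.
  transitivity (\rank W) => //.
  apply/eqP; rewrite eqn_leq; apply/andP; split; apply: mxrankS.
    by apply/row_subP=> i; rewrite row_diff_mx xS x0 MW ?enum_valP.
  (* Row space inclusion is tested against the cokernel [C] of the differences: each column of [C]
     is a form constant on [M], hence killed by [W]. *)
  rewrite submxE; have := mulmx_coker (diff_mx x).
  move: (cokermx _) => C DC0; apply/eqP/matrixP=> i j; rewrite [RHS]mxE.
  transitivity ((W *m (C *m delta_mx j 0)) i (0 : 'I_1)).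
    by rewrite mulmxA -colE [RHS]mxE.
  rewrite dualW ?[LHS]mxE // => a aM.
  have -> : g a - g a0 = row (enum_rank_in a0M a) (diff_mx x).
    by rewrite row_diff_mx xS x0 enum_rankK_in.
  by rewrite -row_mul mulmxA DC0 mul0mx row0.
move=> n x xM; apply: leq_trans (eq_leq rkW); apply/mxrankS/row_subP=> i.
have -> : row i (diff_mx x) = (x (lift ord0 i) - g a0) - (x ord0 - g a0).
  by rewrite row_diff_mx opprB addrA subrK.
by rewrite addmx_sub ?eqmx_opp ?(hull_sub_mx (xM _) MW).
Qed.

Lemma affdim_uniq (F : 'rV[R]_d -> Prop) k k' :
  affdim F k -> affdim F k' -> k = k'.
Proof.
move=> [[n [x [Fx rk]]] le_k] [[n' [x' [Fx' rk']]] le_k'].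
by apply/eqP; rewrite eqn_leq -{1}rk -{2}rk' le_k // le_k'.
Qed.

Lemma affdim_hull0 M : injective g ->
  affdim (hull M) 0 <-> exists a, M = [set a].
Proof.
move=> g_inj; split=> [[[n [x [xM _]]] le0]|[a ->]]; last first.
  apply: (@affdim_hull _ 0 0 a); rewrite ?set11 ?/row_free ?mxrank0 //.
    by move=> b /set1P ->; rewrite subrr sub0mx.
  by move=> c _; rewrite mul0mx.
have [a aM] := hull_nonempty (xM ord0); exists a.
apply/eqP; rewrite eqEsubset sub1set aM andbT; apply/subsetP=> b bM.
pose y (i : 'I_2) := if i == ord0 then g a else g b.
have /le0 : forall i, hull M (y i).
  by move=> i; rewrite /y; case: ifP => _; apply: sub_hull.
rewrite leqn0 mxrank_eq0 => /eqP y0.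
have := row_diff_mx y 0; rewrite y0 row0 /y /= => /esym/eqP.
by rewrite subr_eq0 => /eqP/g_inj ->; rewrite set11.
Qed.

Lemma num_faces_hull X k (Fam : {set {set I}}) : X != set0 ->
  (forall M, M \in Fam <->
     (exists c, M = argmax X c) /\ affdim (hull M) k) ->
  num_faces (hull X) k #|Fam|.
Proof.
move=> X0 FamP; exists (fun i => hull (enum_val i)); split.
  move=> i j eqh; apply: enum_val_inj; move: eqh.
  have [[c ->] _] := (FamP _).1 (enum_valP i).
  have [[c' ->] _] := (FamP _).1 (enum_valP j).
  exact: hull_argmax_inj.
move=> F; split=> [[/(is_face_hullP _ X0)[c ->] dimk]|[i ->]].
  have MF : argmax X c \in Fam by apply/FamP; split=> //; exists c.
  by exists (enum_rank_in MF (argmax X c)); rewrite enum_rankK_in.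
have [[c eqM] dimk] := (FamP _).1 (enum_valP i); split=> //.
by apply/is_face_hullP => //; exists c; rewrite -eqM.
Qed.

(** The direction space is the hyperplane where the sum of [y i / h i] vanishes, inside the span of
    the coordinates of [S]; a basis is given by [h i] times the unit vector at [i] minus [h i0]
    times the one at [i0]. The last hypothesis says that a form constant on [M] is proportional to
    [1 / h] on [S], so it kills this basis. Simplices use [h = 1], hypersimplices
    [h i = q ^+ b i]. *)
Lemma affdim_hull_weighted M (S : {set 'I_d}) i0 (h : 'I_d -> R) a0 :
  a0 \in M -> i0 \in S -> (forall i, h i != 0) ->
  (forall a i, a \in M -> i \notin S -> g a 0 i = g a0 0 i) ->
  (forall a, a \in M ->
     \sum_(i in S) g a 0 i / h i = \sum_(i in S) g a0 0 i / h i) ->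
  (forall c : 'cV_d, (forall a, a \in M -> (g a - g a0) *m c = 0) ->
     forall i, i \in S -> h i * c i 0 = h i0 * c i0 0) ->
  affdim (hull M) #|S|.-1.
Proof.
move=> a0M i0S h0 suppM sumM dualM.
have -> : #|S|.-1 = #|S :\ i0| by rewrite (cardsD1 i0 S) i0S.
pose ev (k : 'I_#|S :\ i0|) : 'I_d := enum_val k.
have evS l : ev l \in S :\ i0 by apply: enum_valP.
have ev_neq l : (ev l == i0) = false by have := evS l; rewrite !inE => /andP[/negPf].
pose W := \matrix_(k < #|S :\ i0|, j < d)
  (h (ev k) * (ev k == j)%:R - h i0 * (i0 == j)%:R).
apply: (@affdim_hull M _ W a0) => // [|a aM|c /dualM hc].
(* Dropping the coordinate [i0] leaves the diagonal matrix of the [h (ev k)], which is inverted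
   entrywise. *)
- apply/row_freeP; exists (\matrix_(j, l) ((ev l == j)%:R / h (ev l))).
  apply/matrixP=> k l; rewrite !mxE (bigD1 (ev l)) //= !mxE eqxx.
  rewrite [i0 == _]eq_sym ev_neq mulr0 subr0 (inj_eq enum_val_inj).
  rewrite big1 => [|j]; last first.
    by rewrite !mxE [ev l == j]eq_sym => /negPf ->; rewrite mul0r mulr0.
  case: eqP => [->|_]; last by rewrite mulr0 mul0r addr0.
  by rewrite mulr1 mul1r divff ?addr0.
(* The coefficients in the basis are read off the coordinates other than [i0]; the coordinate [i0]
   then agrees because of [y_sum]. *)
- apply/submxP; exists (\row_l ((g a - g a0) 0 (ev l) / h (ev l))).
  pose y i := (g a - g a0) 0 i.
  have y_sum : \sum_(i in S) y i / h i = 0.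
    under eq_bigr do rewrite /y !mxE mulrBl.
    by rewrite sumrB sumM ?subrr.
  apply/rowP=> j; rewrite [RHS]mxE -/(y j).
  under eq_bigr do rewrite !mxE -/(y _).
  transitivity (\sum_(i in S :\ i0)
      y i / h i * (h i * (i == j)%:R - h i0 * (i0 == j)%:R)); last first.
    by rewrite big_enum_val; apply: eq_bigr => k _; rewrite /y !mxE.
  have [jS|jS] := boolP (j \in S); last first.
    rewrite big1 => [|i]; first by rewrite /y !mxE suppM ?subrr.
    rewrite !inE => /andP[_ iS]; have /negPf -> : i != j by apply: contraNneq jS => <-.
    have /negPf -> : i0 != j by apply: contraNneq jS => <-.
    by rewrite !mulr0 subrr mulr0.
  have [->|ne_j] := eqVneq j i0.
    move: y_sum; rewrite (big_setD1 i0) //= => /eqP; rewrite addr_eq0 => /eqP y0.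
    transitivity (\sum_(i in S :\ i0) - (y i / h i) * h i0).
      by rewrite -mulr_suml sumrN -y0 divfK.
    apply: eq_bigr => i; rewrite !inE => /andP[/negPf -> _].
    by rewrite mulr0 sub0r mulr1 mulrN mulNr.
  rewrite (bigD1 j) ?inE ?ne_j //= eqxx mulr0 subr0 mulr1.
  rewrite divfK // big1 ?addr0 // => i /andP[_ /negPf ->].
  by rewrite !mulr0 subrr mulr0.
apply/matrixP=> k j; rewrite (ord1 j) !mxE.
transitivity (h (ev k) * c (ev k) 0 - h i0 * c i0 0); last first.
  by rewrite hc ?subrr //; have := evS k; rewrite inE => /andP[].
rewrite (bigD1 (ev k)) // (bigD1 i0) 1?eq_sym ?ev_neq //= !mxE !eqxx ev_neq.
rewrite eq_sym ev_neq !mulr0 !mulr1 subr0 sub0r mulNr.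
rewrite big1 ?addr0 // => i /andP[/negPf n1 /negPf n2].
by rewrite !mxE ![_ == i]eq_sym n1 n2 !mulr0 subrr mul0r.
Qed.

(** Here no linear relation holds on the coordinates of [Z], so the unit vectors of [Z] span the
    direction space. *)
Lemma affdim_hull_coord M (Z : {set 'I_d}) a0 : a0 \in M ->
  (forall a i, a \in M -> i \notin Z -> g a 0 i = g a0 0 i) ->
  (forall c : 'cV_d, (forall a, a \in M -> (g a - g a0) *m c = 0) ->
     forall i, i \in Z -> c i 0 = 0) ->
  affdim (hull M) #|Z|.
Proof.
move=> a0M suppM dualM.
pose ev (k : 'I_#|Z|) : 'I_d := enum_val k.
pose W : 'M[R]_(#|Z|, d) := \matrix_(l, j) (ev l == j)%:R.
apply: (@affdim_hull M _ W a0) => // [|a aM|c /dualM hc].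
- apply/row_freeP; exists W^T.
  apply/matrixP=> k l; rewrite !mxE (bigD1 (ev l)) //= !mxE eqxx mulr1.
  rewrite (inj_eq enum_val_inj) big1 ?addr0 // => j.
  by rewrite !mxE [ev l == j]eq_sym => /negPf ->; rewrite mulr0.
- apply/submxP; exists (\row_l (g a - g a0) 0 (ev l)).
  pose y i := (g a - g a0) 0 i.
  apply/rowP=> j; rewrite [RHS]mxE -/(y j).
  transitivity (\sum_(i in Z) y i * (i == j)%:R); last first.
    by rewrite big_enum_val; apply: eq_bigr => k _; rewrite /y !mxE.
  have [jZ|jZ] := boolP (j \in Z).
    rewrite (bigD1 j) //= eqxx mulr1 big1 ?addr0 // => i /andP[_ /negPf ->].
    by rewrite mulr0.
  rewrite big1 => [|i iZ]; first by rewrite /y !mxE suppM ?subrr.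
  by have /negPf -> : i != j; [apply: contraNneq jZ => <-|rewrite mulr0].
apply/matrixP=> k j; rewrite (ord1 j) !mxE (bigD1 (ev k)) //= !mxE eqxx mul1r.
rewrite hc ?enum_valP // add0r big1 // => i.
by rewrite !mxE [_ == i]eq_sym => /negPf ->; rewrite mul0r.
Qed.

End Hull.

(** * Affine bounds for exponentials *)

Section Exponential.
Local Open Scope ring_scope.
Variables (R : realFieldType) (q : R).
Hypothesis q_gt1 : 1 < q.
Implicit Types (c w t m : R) (b n e : nat).

(* [w q^n - t (q - 1) n] decreases as long as [w q^n < t] and increases
   afterwards. *)
Lemma leif_expr_tangent w t b n : 0 < w -> t <= w * q ^+ b ->
  (forall i, (i < b)%N -> w * q ^+ i < t) ->
  w * q ^+ b + t * (q - 1) * (n%:R - b%:R) <= w * q ^+ n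
    ?= iff (n == b) || (n == b.+1) && (w * q ^+ b == t).
Proof.
move=> w0 tb lt_t; have q0 : 0 < q - 1 by rewrite subr_gt0.
(* Steps of [w * q ^+ n] have size [(q - 1) * (w * q ^+ n)]. The step out of [b] is at least
   [t * (q - 1)], with equality exactly when [w * q ^+ b = t], and every later step is strictly
   larger. *)
have up k : t * (q - 1) * k.+1%:R <= w * q ^+ (b + k).+1 - w * q ^+ b
    ?= iff (k == 0%N) && (w * q ^+ b == t).
  apply/leifP; elim: k => [|k IHk] /=.
    rewrite addn0 mulr1 exprS.
    case: eqP => [<-|/eqP ne]; first by apply/eqP; ring.
    have : 0 < (q - 1) * (w * q ^+ b - t).
      by rewrite mulr_gt0 // subr_gt0 lt_neqAle eq_sym ne.
    by lra.
  have step : 0 < (q - 1) * (w * q ^+ (b + k).+1 - t).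
    rewrite mulr_gt0 // subr_gt0 (le_lt_trans tb) // ltr_pM2l //.
    by rewrite ltr_eXn2l // ltnS leq_addr.
  have {}IHk : t * (q - 1) * k.+1%:R <= w * q ^+ (b + k).+1 - w * q ^+ b.
    by move: IHk; case: ifP => _ => [/eqP ->|/ltW].
  by rewrite addnS [q ^+ (b + k).+2]exprS -[k.+2%:R]natr1; lra.
(* Below [b] every step is strictly smaller than [t * (q - 1)], so no equality occurs on this
   side. *)
have down k : (k < b)%N ->
    w * q ^+ b - w * q ^+ (b - k.+1) < t * (q - 1) * k.+1%:R.
  have step i : (i < b)%N -> w * q ^+ (b - i) - w * q ^+ (b - i.+1) < t * (q - 1).
    move=> lt_ib; rewrite -subSS subSn // exprS.
    have : 0 < (q - 1) * (t - w * q ^+ (b - i.+1)).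
      by rewrite mulr_gt0 // subr_gt0 lt_t // ltn_subrL (leq_ltn_trans _ lt_ib).
    by lra.
  elim: k => [|k IHk] lt_kb; first by have := step _ lt_kb; rewrite subn0; lra.
  have := step _ lt_kb; have := IHk (ltnW lt_kb).
  by rewrite -[k.+2%:R]natr1; lra.
apply/leifP; have [lt_nb|lt_bn|->] := ltngtP n b; last first.
- by rewrite subrr mulr0 addr0 eqxx.
- have [k ->] : exists k, n = (b + k).+1.
    by exists (n - b.+1)%N; rewrite -addSn subnKC.
  have -> : ((b + k).+1 == b.+1) = (k == 0%N) by lia.
  have /leifP := up k.
  rewrite -addnS natrD => H /=.
  by case: ifP H => _ => [/eqP|]; [move=> H; apply/eqP|]; lra.
- have lt_b : (b - n.+1 < b)%N by rewrite ltn_subrL (leq_ltn_trans _ lt_nb).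
  have := down _ lt_b; rewrite -subSn // subSS subKn ?(ltnW lt_nb) //.
  rewrite natrB ?(ltnW lt_nb) //= (_ : (n == b.+1) = false) /=; last by lia.
  by lra.
Qed.

(** This is the strict growth of [(q ^+ n - 1) / n], the slope of the chord of the exponential over
    [[0, n]], with denominators cleared. *)
Lemma ltr_expr_chord n e : (0 < n < e)%N ->
  (q ^+ n - 1) * e%:R < n%:R * (q ^+ e - 1).
Proof.
have q0 : 0 < q by apply: lt_trans q_gt1.
have D i : (q ^+ i.+1 - 1) * i.+2%:R < i.+1%:R * (q ^+ i.+2 - 1).
  elim: i => [|i IHi].
    have : 0 < (q - 1) * (q - 1) by rewrite mulr_gt0 ?subr_gt0.
    by rewrite expr1 expr2; lra.
  (* This positive amount is exactly the growth from [i] to [i.+1] of the gap between the two sides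
     of [D]. *)
  have : 0 < i.+2%:R * (q ^+ i.+1 * ((q - 1) * (q - 1))).
    by rewrite !mulr_gt0 ?subr_gt0 ?exprn_gt0 ?ltr0n.
  move: IHi; rewrite ![q ^+ _.+1]exprS.
  by rewrite -[i.+3%:R]natr1 -[i.+2%:R]natr1 -[i.+1%:R]natr1; lra.
case/andP=> n0 lt_ne.
have H i : (q ^+ i.+1 - 1) / i.+1%:R < (q ^+ i.+2 - 1) / i.+2%:R.
  by rewrite ltr_pdivrMr ?ltr0n // mulrAC ltr_pdivlMr ?ltr0n // [ltRHS]mulrC.
have /(_ n.-1 e.-1) := Order.NatMonotonyTheory.homo_ltn_lt H.
rewrite !prednK //; last exact: leq_ltn_trans lt_ne.
rewrite !ltEnat /= => /(_ _)H2; have := H2 ltac:(lia).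
rewrite ltr_pdivrMr ?ltr0n // mulrAC ltr_pdivlMr ?ltr0n; last by lia.
by rewrite [ltRHS]mulrC.
Qed.

(** The term [c * (q ^+ n - 1)] is at most [m * (q ^+ n - 1)], which strict convexity keeps under
    its chord over [[0, e]]. The slope depends on [m] alone, so it can serve all coordinates at
    once. *)
Lemma leif_expr_chord c m e n : (0 < e)%N -> 0 < m -> c <= m -> (n <= e)%N ->
  c * q ^+ n <= c + m * (q ^+ e - 1) / e%:R * n%:R
    ?= iff (n == 0%N) || (n == e) && (c == m).
Proof.
move=> e0 m0 cm ne; have eR : 0 < e%:R :> R by rewrite ltr0n.
have eN : e%:R != 0 :> R by rewrite gt_eqF.
apply/leifP; case: (posnP n) => [->|n0] /=.
  by rewrite mulr1 mulr0 addr0.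
have qn : 1 < q ^+ n by rewrite exprn_egt1 // -lt0n.
have [eq_ne|ne'] := eqVneq n e.
  rewrite eq_ne divfK //; rewrite eq_ne in qn.
  case: eqP => [->|/eqP cm']; first by apply/eqP; ring.
  have : 0 < (m - c) * (q ^+ e - 1).
    by rewrite mulr_gt0 ?subr_gt0 // lt_neqAle cm'.
  by rewrite /=; lra.
have lt_ne : (0 < n < e)%N by rewrite n0 ltn_neqAle ne' ne.
have H1 : c * (q ^+ n - 1) <= m * (q ^+ n - 1).
  by rewrite ler_wpM2r // subr_ge0 ltW.
have H2 : m * (q ^+ n - 1) < m * (q ^+ e - 1) / e%:R * n%:R.
  rewrite -!mulrA ltr_pM2l // mulrA.
  by rewrite mulrAC ltr_pdivlMr // [ltRHS]mulrC ltr_expr_chord.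
by rewrite /=; lra.
Qed.

Lemma leif_expr_const c n : c <= 0 ->
  c * q ^+ n <= c ?= iff (n == 0%N) || (c == 0).
Proof.
move=> c0; apply/leifP; case: (posnP n) => [->|n0] /=; first by rewrite mulr1.
case: eqP => [->|/eqP cN]; first by rewrite mul0r.
rewrite -[ltRHS]mulr1 ltr_nM2l; last by rewrite lt_neqAle cN.
by rewrite exprn_egt1 // -lt0n.
Qed.

End Exponential.

(** * Compositions *)

Section Compositions.
Variables d e : nat.
Notation exponent := {ffun 'I_d -> 'I_e.+1}.
Implicit Types (a : exponent) (b : 'I_d -> nat) (S Z : {set 'I_d}).

Definition composition := [set a : exponent | \sum_(i < d) a i == e].

(* [inord] truncates: meaningful only when [f] sums to [e]. *)
Definition to_exponent (f : 'I_d -> nat) : exponent := [ffun i => inord (f i)].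

Lemma to_exponentE f i : \sum_(i < d) f i = e -> to_exponent f i = f i :> nat.
Proof.
by move=> fe; rewrite ffunE inordK // ltnS -fe (bigD1 i) //= leq_addr.
Qed.

Lemma to_exponent_composition f :
  \sum_(i < d) f i = e -> to_exponent f \in composition.
Proof.
move=> fe; rewrite inE; under eq_bigr do rewrite to_exponentE //.
by rewrite fe.
Qed.

Definition corner (i : 'I_d) := to_exponent (fun j => if j == i then e else 0).

Let corner_sum (i : 'I_d) : \sum_(j < d) (if j == i then e else 0) = e.
Proof. by rewrite (bigD1 i) //= eqxx big1 ?addn0 // => j /negPf ->. Qed.

Lemma cornerE i j : corner i j = (if j == i then e else 0) :> nat.
Proof. exact: to_exponentE. Qed.

Lemma corner_composition i : corner i \in composition.
Proof. exact: to_exponent_composition. Qed.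

(** Equality in a sum of coordinate bounds is a condition on each coordinate separately, which gives
    sets of maximisers this shape. *)
Definition coordwise (E : 'I_d -> nat -> bool) :=
  [set a in composition | [forall j, E j (a j)]].

Lemma coordwiseP (E : 'I_d -> nat -> bool) a :
  reflect (\sum_(i < d) a i = e /\ forall j, E j (a j)) (a \in coordwise E).
Proof.
rewrite !inE; apply: (iffP andP) => -[].
  by move=> /eqP ? /forallP.
by move=> -> ?; split=> //; apply/forallP.
Qed.

(** * The three families of sets of maximisers *)

Definition top_face S :=
  coordwise (fun j n => (n == 0) || (n == e) && (j \in S)).
Definition coord_face Z := coordwise (fun j n => (n == 0) || (j \in Z)).
Definition bottom_face S b :=
  coordwise (fun j n => (n == b j) || (n == (b j).+1) && (j \in S)).

Lemma corner_top S i : 0 < e -> (corner i \in top_face S) = (i \in S).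
Proof.
move=> e0; apply/coordwiseP/idP => [[_ /(_ i)]|iS].
  by rewrite cornerE eqxx eqn0Ngt e0 eqxx.
split=> [|j]; first by under eq_bigr do rewrite cornerE.
by rewrite cornerE; case: (eqVneq j i) => [->|]; rewrite eqxx ?iS ?orbT.
Qed.

Lemma corner_coord Z i : 0 < e -> (corner i \in coord_face Z) = (i \in Z).
Proof.
move=> e0; apply/coordwiseP/idP => [[_ /(_ i)]|iS].
  by rewrite cornerE eqxx eqn0Ngt e0.
split=> [|j]; first by under eq_bigr do rewrite cornerE.
by rewrite cornerE; case: (eqVneq j i) => [->|]; rewrite ?eqxx ?iS ?orbT.
Qed.

Lemma composition_pos a : 0 < e -> a \in composition -> exists i, 0 < a i.
Proof.
move=> e0; rewrite inE => /eqP ae; apply/existsP; apply: contraTT e0.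
rewrite negb_exists => /forallP a0; rewrite -ae big1 // => i _.
by apply/eqP; rewrite eqn0Ngt a0.
Qed.

Lemma top_faceP S a : 0 < e ->
  a \in top_face S -> exists2 i, i \in S & a = corner i.
Proof.
move=> e0 aS; have [ae aE] := coordwiseP _ _ aS.
have [i ai0] : exists i, 0 < a i by apply: composition_pos; rewrite // inE ae.
have := aE i; rewrite eqn0Ngt ai0 /= => /andP[/eqP aie iS].
exists i => //; apply/ffunP => j; apply/val_inj; rewrite /= cornerE.
case: eqVneq => [->//|ne]; move: ae.
by rewrite (bigD1 i) // (bigD1 j) //= aie; lia.
Qed.

Lemma bottom_face_sum S b a : a \in bottom_face S b ->
  exists2 T : {set 'I_d}, T \subset S & forall j : 'I_d, a j = b j + (j \in T) :> nat.
Proof.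
case/coordwiseP=> _ aE; exists [set j | a j == (b j).+1 :> nat].
  apply/subsetP=> j; rewrite inE => /eqP aj.
  by move: (aE j); rewrite aj; case: (j \in S) => //; lia.
move=> j; rewrite inE; move: (aE j); case: eqP => /= [->|_].
  by rewrite ltn_eqF // addn0.
by case/andP=> /eqP ->; rewrite eqxx addn1.
Qed.

Lemma sum_addn_mem b (T : {set 'I_d}) :
  \sum_(j < d) (b j + (j \in T)) = \sum_(j < d) b j + #|T|.
Proof.
rewrite big_split /= -sum1_card [in X in _ = _ + X]big_mkcond /=.
by congr addn; apply: eq_bigr => j _; case: (j \in T).
Qed.

Lemma mem_bottom_face S b (T : {set 'I_d}) :
  T \subset S -> \sum_(j < d) b j + #|T| = e ->
  to_exponent (fun j => b j + (j \in T)) \in bottom_face S b.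
Proof.
move=> /subsetP sTS bT; have sumT : \sum_(j < d) (b j + (j \in T)) = e.
  by rewrite sum_addn_mem.
apply/coordwiseP; split=> [|j].
  by under eq_bigr do rewrite to_exponentE //.
rewrite to_exponentE //; case: (boolP (j \in T)) => [/sTS ->|_].
  by rewrite addn1 eqxx orbT.
by rewrite addn0 eqxx.
Qed.

Lemma bottom_face_bounds S b a : a \in bottom_face S b ->
  \sum_(j < d) b j <= e <= \sum_(j < d) b j + #|S|.
Proof.
move=> aL; have [T sTS aT] := bottom_face_sum aL.
case/coordwiseP: aL => ae _; have := subset_leq_card sTS.
move: ae; under eq_bigr do rewrite aT.
by rewrite sum_addn_mem; lia.
Qed.

(** The set of raised coordinates is forced to be empty at one end of the range and equal to [S] at
    the other. *)
Lemma bottom_face_extreme S b a a' :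
  (\sum_(j < d) b j == e) || (\sum_(j < d) b j + #|S| == e) ->
  a \in bottom_face S b -> a' \in bottom_face S b -> a = a'.
Proof.
move=> ext aL a'L; have [T sTS aT] := bottom_face_sum aL.
have [T' sTS' aT'] := bottom_face_sum a'L.
have TE (U : {set 'I_d}) : U \subset S -> \sum_(j < d) b j + #|U| = e ->
    U = if \sum_(j < d) b j == e then set0 else S.
  move=> sUS cU; case: ifP ext => /= [/eqP bj _|_ /eqP ext].
    by apply/eqP; move/eqP: cU; rewrite bj -[X in _ == X]addn0 eqn_add2l cards_eq0.
  by apply/eqP; rewrite eqEcard sUS -(leq_add2l (\sum_(j < d) b j)) cU ext leqnn.
have cT : \sum_(j < d) b j + #|T| = e.
  by case/coordwiseP: aL => ae _; rewrite -sum_addn_mem -[RHS]ae; apply: eq_bigr.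
have cT' : \sum_(j < d) b j + #|T'| = e.
  by case/coordwiseP: a'L => ae _; rewrite -sum_addn_mem -[RHS]ae; apply: eq_bigr.
by apply/ffunP=> j; apply/val_inj; rewrite /= aT aT' (TE T) // (TE T').
Qed.

(** The raised sets are [i |: T] and [j |: T] for one [T] avoiding both indices. Such a pair differs
    by one unit moved between [i] and [j], which later compares the coefficients of a form at [i]
    and [j]. *)
Lemma bottom_face_swap S b i j : i != j -> i \in S -> j \in S ->
  \sum_(j < d) b j < e < \sum_(j < d) b j + #|S| ->
  exists a a', [/\ a \in bottom_face S b, a' \in bottom_face S b &
    forall k, a k + (k == j) = a' k + (k == i) /\
    (a i = (b i).+1 :> nat) /\ (a j = b j :> nat)].
Proof.
move=> ne_ij iS jS be.
(* One raised coordinate is reserved for [i] or [j]; by the strict bounds the others fit into the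
   remaining [#|S| - 2] indices. *)
have [T sTS cT] : exists2 T : {set 'I_d},
    T \subset S :\ i :\ j & #|T| = (e - \sum_(j < d) b j).-1.
  have : 0 < #|[set T : {set 'I_d} | T \subset S :\ i :\ j &
      #|T| == (e - \sum_(j < d) b j).-1]|.
    rewrite cards_draws bin_gt0; move: be.
    rewrite (cardsD1 i S) iS (cardsD1 j (S :\ i)) !inE jS eq_sym ne_ij.
    by move: #|_| => s; lia.
  by case/card_gt0P => T; rewrite inE => /andP[? /eqP]; exists T.
have iT : i \notin T by apply/negP => /(subsetP sTS); rewrite !inE eqxx andbF.
have jT : j \notin T by apply/negP => /(subsetP sTS); rewrite !inE eqxx.
have sT k : k \in S -> k |: T \subset S.
  move=> kS; rewrite subUset sub1set kS.
  by apply: (subset_trans sTS); rewrite (subset_trans (subsetDl _ _)) ?subsetDl.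
have sumT k : k \notin T -> \sum_(j < d) b j + #|k |: T| = e.
  by move=> kT; rewrite cardsU1 kT cT; lia.
exists (to_exponent (fun l => b l + (l \in i |: T))).
exists (to_exponent (fun l => b l + (l \in j |: T))).
split; try by apply: mem_bottom_face; rewrite ?sT ?sumT.
move=> k; rewrite !to_exponentE ?sum_addn_mem ?sumT //.
rewrite !inE eqxx (negPf jT) [j == i]eq_sym (negPf ne_ij) /= addn0 addn1.
split=> //.
have [->|_] := eqVneq k i; first by rewrite (negPf ne_ij) (negPf iT) /= !addn0.
by have [->|_] := eqVneq k j; rewrite ?(negPf jT) /= ?addn0.
Qed.

Lemma card_mem_neq (S : {set 'I_d}) i : 1 < #|S| -> exists2 j, j \in S & j != i.
Proof.
move=> S1; have : 0 < #|S :\ i|.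
  by move: S1; rewrite (cardsD1 i S); case: (i \in S) => //= /ltnW.
by case/card_gt0P=> j; rewrite !inE => /andP[? ?]; exists j.
Qed.

Section BottomFace.
Variables (S : {set 'I_d}) (b : 'I_d -> nat).
Hypothesis be : \sum_(j < d) b j < e < \sum_(j < d) b j + #|S|.

Lemma bottom_face_dim : 1 < #|S|.
Proof. by move: be; move: #|S| => s; lia. Qed.

Lemma bottom_face_high i : i \in S ->
  exists2 a, a \in bottom_face S b & a i = (b i).+1 :> nat.
Proof.
move=> iS; have [j jS ne_ji] := card_mem_neq i bottom_face_dim.
rewrite eq_sym in ne_ji.
by have [a [_ [aL _ /(_ i)[_ [ai _]]]]] := bottom_face_swap ne_ji iS jS be; exists a.
Qed.

Lemma bottom_face_low i :
  exists2 a, a \in bottom_face S b & a i = b i :> nat.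
Proof.
have [j jS ne_ji] := card_mem_neq i bottom_face_dim.
have [iS|iS] := boolP (i \in S).
  by have [a [_ [aL _ /(_ i)[_ [_ ai]]]]] := bottom_face_swap ne_ji jS iS be; exists a.
have [a aL _] := bottom_face_high jS; exists a => //.
case/coordwiseP: aL => _ /(_ i); rewrite (negPf iS) andbF orbF.
by move/eqP.
Qed.

End BottomFace.

(** Under the strict bounds, [b i] is the least value of coordinate [i] on the face, and [S]
    collects the coordinates that also take the value [(b i).+1]. *)
Lemma bottom_face_inj S S' b b' :
  \sum_(j < d) b j < e < \sum_(j < d) b j + #|S| ->
  \sum_(j < d) b' j < e < \sum_(j < d) b' j + #|S'| ->
  bottom_face S b = bottom_face S' b' -> S = S' /\ forall i, b i = b' i.
Proof.
suff sub S1 S2 b1 b2 :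
    \sum_(j < d) b1 j < e < \sum_(j < d) b1 j + #|S1| ->
    \sum_(j < d) b2 j < e < \sum_(j < d) b2 j + #|S2| ->
    bottom_face S1 b1 = bottom_face S2 b2 ->
    (forall i, b1 i = b2 i) /\ S1 \subset S2.
  move=> be b'e eqL; have [bb' sSS'] := sub _ _ _ _ be b'e eqL.
  have [_ sS'S] := sub _ _ _ _ b'e be (esym eqL).
  by split=> //; apply/eqP; rewrite eqEsubset sSS'.
move=> be1 be2 eqL; have eqb i : b1 i = b2 i.
  apply/anti_leq/andP; split.
    have [a] := bottom_face_low be2 i; rewrite -eqL => /coordwiseP[_ /(_ i)].
    by move=> /[swap] ->; lia.
  have [a] := bottom_face_low be1 i; rewrite eqL => /coordwiseP[_ /(_ i)].
  by move=> /[swap] ->; lia.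
split=> //; apply/subsetP=> i iS1.
have [a] := bottom_face_high be1 iS1; rewrite eqL => /coordwiseP[_ /(_ i)].
by move=> /[swap] ->; rewrite eqb; case: (i \in S2) => //; lia.
Qed.

(** A coordinate varies by at most 1 on a bottom face, whereas two corners differ there by [e]. This
    separates bottom faces from the other families. *)
Lemma corners_bottomN S b i j : 1 < e -> i != j ->
  corner i \in bottom_face S b -> corner j \notin bottom_face S b.
Proof.
move=> e1 ne_ij /coordwiseP[_ /(_ i)]; rewrite cornerE eqxx => bi.
apply/negP=> /coordwiseP[_ /(_ i)]; rewrite cornerE (negPf ne_ij); move: bi.
by case: (i \in S); lia.
Qed.

(** * Counting compositions and face sets *)

Lemma card_exponent_leq n : n <= e ->
  #|[set b : exponent | \sum_(j < d) b j <= n]| = 'C(d + n, d).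
Proof.
move=> ne; rewrite -(card_partial_ord_partitions d n).
pose f (t : d.-tuple 'I_n.+1) : exponent := to_exponent (tnth t).
have fE t j : f t j = tnth t j :> nat.
  by rewrite ffunE inordK // (leq_trans (ltn_ord _)).
rewrite -(@card_imset _ _ f); last first.
  by move=> t t' /ffunP eqf; apply/eq_from_tnth => j; apply/val_inj;
    rewrite /= -!fE eqf.
apply: eq_card => b; rewrite inE; apply/idP/imsetP => [bn|[t + ->]]; last first.
  by rewrite inE big_tuple; under eq_bigr do rewrite -fE.
have b_le j : b j < n.+1 by rewrite ltnS (leq_trans _ bn) // (bigD1 j) //= leq_addr.
exists [tuple inord (b j) | j < d].
  rewrite inE big_tuple; under eq_bigr do rewrite tnth_mktuple inordK //.
  exact: bn.
by apply/ffunP=> j; apply/val_inj; rewrite /= fE tnth_mktuple inordK.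
Qed.

Lemma card_composition : 0 < d -> 0 < e ->
  #|composition| = 'C(e + d - 1, d - 1).
Proof.
move=> d0 e0.
have -> : composition = [set b : exponent | \sum_(j < d) b j <= e]
    :\: [set b : exponent | \sum_(j < d) b j <= e.-1].
  by apply/setP=> a; rewrite !inE; lia.
rewrite cardsD (setIidPr _); last by apply/subsetP=> a; rewrite !inE; lia.
rewrite !card_exponent_leq ?leq_pred //.
have -> : d + e = (d + e.-1).+1 by lia.
have -> : e + d - 1 = d + e.-1 by lia.
by case: d d0 => // d' _; rewrite binS addKn subn1.
Qed.

(** For [#|S| = k.+1] these bases leave between 1 and [k] coordinates to raise: the hypersimplices
    that are not a single point. *)
Definition bottom_bases k :=
  [set b : exponent | \sum_(j < d) b j < e < \sum_(j < d) b j + k.+1].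

Lemma card_bottom_bases k : 0 < d -> 0 < e ->
  #|bottom_bases k| = 'C(e + d - 1, d) - 'C(e + d - 1 - k, d).
Proof.
move=> d0 e0.
have -> : bottom_bases k = [set b : exponent | \sum_(j < d) b j <= e.-1]
    :\: [set b : exponent | \sum_(j < d) b j + k < e].
  by apply/setP=> a; rewrite !inE; lia.
rewrite cardsD (setIidPr _); last by apply/subsetP=> a; rewrite !inE; lia.
rewrite card_exponent_leq ?leq_pred //; congr (_ - _).
  by congr 'C(_, _); lia.
(* The removed bases have total at most [e - 1 - k]. When [e <= k] there are none, and the binomial
   vanishes as its upper entry is below [d]. *)
have [le_ek|lt_ke] := leqP e k.
  rewrite bin_small; last by lia.
  by apply/eqP; rewrite cards_eq0; apply/eqP/setP=> a; rewrite !inE; lia.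
have -> : e + d - 1 - k = d + (e.-1 - k) by lia.
rewrite -card_exponent_leq; last by lia.
by apply: eq_card => a; rewrite !inE; lia.
Qed.

(** The guard [1 < k] excludes singletons [Z], whose coordinate face is one corner and not a
    segment. *)
Definition face_sets k : {set {set exponent}} :=
  [set top_face S | S in [set S : {set 'I_d} | #|S| == k.+1]]
  :|: [set coord_face Z | Z in [set Z : {set 'I_d} | (1 < k) && (#|Z| == k)]]
  :|: [set bottom_face u.1 (fun j => u.2 j)
         | u : {set 'I_d} * exponent
             in setX [set S : {set 'I_d} | #|S| == k.+1] (bottom_bases k)].

(** The corners in a top or coordinate face recover its index set, of size [k.+1] or [k]
    respectively, so these families do not meet. Each of their members has at least two corners, a
    bottom face at most one. *)
Lemma card_face_sets k : 0 < d -> 1 < e -> 0 < k ->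
  #|face_sets k| = 'C(d, k.+1) + (if 1 < k then 'C(d, k) else 0)
    + 'C(d, k.+1) * ('C(e + d - 1, d) - 'C(e + d - 1 - k, d)).
Proof.
move=> d0 e1 k0; have e0 := ltnW e1.
have two_corners (S : {set 'I_d}) : 1 < #|S| ->
    exists i j, [/\ i \in S, j \in S & i != j].
  move=> S1; have [i iS] : exists i, i \in S by apply/card_gt0P; apply: ltnW.
  by have [j jS ne] := card_mem_neq i S1; exists i, j; rewrite eq_sym.
have disj12 : [disjoint
    [set top_face S | S in [set S : {set 'I_d} | #|S| == k.+1]] &
    [set coord_face Z | Z in [set Z : {set 'I_d} | (1 < k) && (#|Z| == k)]]].
  apply/pred0P=> M /=; apply/negP=> /andP[/imsetP[S + ->] /imsetP[Z]].
  rewrite !inE => /eqP cS /andP[_ /eqP cZ] eqSZ.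
  suff eqS : S = Z by rewrite eqS cZ in cS; lia.
  by apply/setP=> i; rewrite -corner_top // eqSZ corner_coord.
have disj3 : [disjoint
    [set top_face S | S in [set S : {set 'I_d} | #|S| == k.+1]] :|:
    [set coord_face Z | Z in [set Z : {set 'I_d} | (1 < k) && (#|Z| == k)]] &
    [set bottom_face u.1 (fun j => u.2 j)
      | u : {set 'I_d} * exponent in setX [set S : {set 'I_d} | #|S| == k.+1] (bottom_bases k)]].
  apply/pred0P=> M /=; apply/negP=> /andP[].
  move=> + /imsetP[[S' b] _ /= eqM]; rewrite {M}eqM => /setUP[]/imsetP[S].
    rewrite inE => /eqP cS eqM.
    have [|i [j [iS jS ne_ij]]] := two_corners S; first by rewrite cS.
    have := @corners_bottomN S' (fun j => b j) i j e1 ne_ij.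
    by rewrite eqM !corner_top // iS jS => /(_ isT).
  rewrite inE => /andP[k1 /eqP cS] eqM.
  have [|i [j [iS jS ne_ij]]] := two_corners S; first by rewrite cS.
  have := @corners_bottomN S' (fun j => b j) i j e1 ne_ij.
  by rewrite eqM !corner_coord // iS jS => /(_ isT).
rewrite /face_sets cardsU (disjoint_setI0 disj3) cards0 subn0.
rewrite cardsU (disjoint_setI0 disj12) cards0 subn0.
congr (_ + _ + _).
- rewrite card_imset ?card_draws ?card_ord // => S S' eqS.
  by apply/setP=> i; rewrite -corner_top // eqS corner_top.
- rewrite card_imset => [|Z Z' eqZ]; last first.
    by apply/setP=> i; rewrite -corner_coord // eqZ corner_coord.
  case: ifP => _; last by apply/eqP; rewrite cards_eq0; apply/eqP/setP=> Z; rewrite !inE.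
  by rewrite card_draws card_ord.
- rewrite -card_bottom_bases // -[X in 'C(X, _)](card_ord d) -card_draws -cardsX.
  apply: card_in_imset => -[S b] [S' b'].
  rewrite !inE /= => /andP[/eqP cS bB] /andP[/eqP cS' bB'] eqL.
  have [||-> eqb] := bottom_face_inj _ _ eqL; rewrite ?cS ?cS' //.
  by congr pair; apply/ffunP=> j; apply/val_inj/eqb.
Qed.

End Compositions.

(** * The polytope of powers *)

Section PowerPolytope.
Local Open Scope ring_scope.
Variables (R : realType) (d e : nat) (q : R).
Hypotheses (q_gt1 : 1 < q) (e_gt1 : (1 < e)%N).
Notation exponent := {ffun 'I_d -> 'I_e.+1}.
Implicit Types (a : exponent) (b : 'I_d -> nat) (S Z : {set 'I_d}).

Definition pow_pt a : 'rV[R]_d := \row_j q ^+ a j.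

Notation X := (composition d e).
Notation argmax_pow := (argmax pow_pt X).

Let q_gt0 : 0 < q. Proof. exact: lt_trans q_gt1. Qed.
Let e_gt0 : (0 < e)%N. Proof. exact: ltnW. Qed.

Lemma pow_pt_inj : injective pow_pt.
Proof.
move=> a a' /rowP eqa; apply/ffunP=> j; apply/val_inj => /=.
by apply: (ieexprIn q_gt0 (negbT (gt_eqF q_gt1))); have := eqa j; rewrite !mxE.
Qed.

Lemma dotv_pow (c : 'rV_d) a : dotv c (pow_pt a) = \sum_j c 0 j * q ^+ a j.
Proof. by apply: eq_bigr => j _; rewrite mxE. Qed.

(* The bound is affine in the exponent, so summing it over the coordinates
   yields the same value [\sum_j al j + tau * e] for every composition. *)
Lemma argmax_coordwise (c : 'rV_d) (al : 'I_d -> R) tau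
    (E : 'I_d -> nat -> bool) :
  (forall j n, (n <= e)%N ->
     c 0 j * q ^+ n <= al j + tau * n%:R ?= iff E j n) ->
  coordwise e E != set0 -> argmax_pow c = coordwise e E.
Proof.
move=> cE /set0Pn[a0 a0E]; pose m := \sum_j al j + tau * e%:R.
have bound a : a \in X ->
    dotv c (pow_pt a) <= m ?= iff [forall j, E j (a j)].
  rewrite inE dotv_pow => /eqP ae.
  have -> : m = \sum_j (al j + tau * (a j)%:R).
    by rewrite big_split /= -mulr_sumr -natr_sum ae.
  by apply: leif_sum => j _; apply: cE; rewrite -ltnS.
have a0m : dotv c (pow_pt a0) = m.
  by move: a0E; rewrite inE => /andP[a0X a0E]; apply/eqP; rewrite (bound _ a0X).
apply/setP=> a; rewrite !inE; apply: andb_id2l => aX.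
have {}aX : a \in X by rewrite inE.
rewrite -(bound a aX); apply/forall_inP/eqP => [a_max|-> b bX].
  apply/eqP; rewrite eq_le (bound a aX) -a0m; apply: a_max.
  by move: a0E; rewrite inE => /andP[].
by rewrite (bound b bX).
Qed.

(** The tangents have slope [t * (q - 1)] in every coordinate; the one at [j] touches at [b j], and
    also at [(b j).+1] exactly when [j] is in [S]. *)
Lemma argmax_bottom (c : 'rV_d) t S b :
  (forall j, c 0 j < 0) ->
  (forall j, t <= - c 0 j * q ^+ b j) ->
  (forall j i, (i < b j)%N -> - c 0 j * q ^+ i < t) ->
  (forall j, (- c 0 j * q ^+ b j == t) = (j \in S)) ->
  bottom_face e S b != set0 -> argmax_pow c = bottom_face e S b.
Proof.
move=> c0 t_le lt_t eq_t.
apply: (@argmax_coordwise c (fun j => c 0 j * q ^+ b j + t * (q - 1) * (b j)%:R)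
  (- (t * (q - 1)))) => j n _.
have w0 : 0 < - c 0 j by rewrite oppr_gt0.
have := leif_expr_tangent q_gt1 n w0 (t_le j) (lt_t j).
rewrite eq_t => -[le eqE]; split; first by lra.
by rewrite -eqE; apply/eqP/eqP => ?; lra.
Qed.

Lemma argmax_top (c : 'rV_d) m S : 0 < m -> (forall j, c 0 j <= m) ->
  (forall j, (c 0 j == m) = (j \in S)) -> S != set0 ->
  argmax_pow c = top_face e S.
Proof.
move=> m0 cm eq_m /set0Pn[i iS].
apply: (@argmax_coordwise c (fun j => c 0 j) (m * (q ^+ e - 1) / e%:R)).
  by move=> j n ne; rewrite -eq_m; apply: leif_expr_chord.
by apply/set0Pn; exists (corner e i); rewrite corner_top.
Qed.

Lemma argmax_coord (c : 'rV_d) Z : (forall j, c 0 j <= 0) ->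
  (forall j, (c 0 j == 0) = (j \in Z)) -> Z != set0 ->
  argmax_pow c = coord_face e Z.
Proof.
move=> c0 eq0 /set0Pn[i iZ].
apply: (@argmax_coordwise c (fun j => c 0 j) 0).
  by move=> j n _; rewrite mul0r addr0 -eq0; apply: leif_expr_const.
by apply/set0Pn; exists (corner e i); rewrite corner_coord.
Qed.

Lemma top_face_argmax S : S != set0 ->
  exists c, argmax_pow c = top_face e S.
Proof.
move=> S0; exists (\row_j (j \in S)%:R); apply: (argmax_top ltr01) => // j.
  by rewrite mxE lern1; case: (j \in S).
by rewrite mxE; case: (j \in S); rewrite ?eqxx // eq_sym oner_eq0.
Qed.

Lemma coord_face_argmax Z : Z != set0 ->
  exists c, argmax_pow c = coord_face e Z.
Proof.
move=> Z0; exists (\row_j - (j \notin Z)%:R); apply: argmax_coord => // j.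
  by rewrite mxE oppr_le0 ler0n.
by rewrite mxE oppr_eq0; case: (j \in Z); rewrite ?eqxx // oner_eq0.
Qed.

Lemma bottom_face_argmax S b : bottom_face e S b != set0 ->
  exists c, argmax_pow c = bottom_face e S b.
Proof.
(* The threshold is normalised to 1. Off [S] the value of [h] is the midpoint of 1 and [q], so the
   threshold is strictly exceeded at [b j] and still missed one exponent earlier. *)
pose h j := if j \in S then 1 else (1 + q) / 2.
have q1 := q_gt1; have h_gt0 j : 0 < h j by rewrite /h; case: ifP => _; lra.
pose c : 'rV[R]_d := \row_j - (h j / q ^+ b j).
have cE j i : - c 0 j * q ^+ i = h j / q ^+ b j * q ^+ i by rewrite mxE opprK.
have cb j : - c 0 j * q ^+ b j = h j by rewrite cE divfK // expf_neq0 // gt_eqF.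
exists c; apply: (@argmax_bottom c 1) => // j.
- by rewrite mxE oppr_lt0 divr_gt0 ?exprn_gt0.
- by rewrite cb /h; case: ifP => _; lra.
- move=> i lt_ib; rewrite cE mulrAC ltr_pdivrMr ?exprn_gt0 // mul1r.
  have : q * q ^+ i <= q ^+ b j by rewrite -exprS ler_weXn2l // ltW.
  apply: lt_le_trans; rewrite ltr_pM2r ?exprn_gt0 //.
  by rewrite /h; case: ifP => _ //; lra.
- by rewrite cb /h; case: ifP => _; [rewrite eqxx|apply: gt_eqF; lra].
Qed.

(** * Classification of the sets of maximisers *)

Lemma sum_swap (V : zmodType) (F F' : 'I_d -> V) i j : i != j ->
  (forall k, k != i -> k != j -> F k = F' k) ->
  \sum_k F k - \sum_k F' k = (F i + F j) - (F' i + F' j).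
Proof.
move=> ne_ij eqF; rewrite (bigD1 i) // (bigD1 j) 1?eq_sym //=.
rewrite [X in _ - X](bigD1 i) // [X in _ - (_ + X)](bigD1 j) 1?eq_sym //=.
rewrite (eq_bigr F') => [|k /andP[ki kj]]; last by apply: eqF.
by rewrite !addrA opprD addrACA subrr addr0.
Qed.

(** Moving one unit from [i] to [j] cannot increase the form; the change carries a factor [q - 1],
    which is divided out. *)
Lemma argmax_exchange (c : 'rV_d) a i j : a \in argmax_pow c -> i != j ->
  (0 < a i)%N -> - c 0 i * q ^+ (a i).-1 <= - c 0 j * q ^+ a j.
Proof.
move=> /setIdP[aX /forall_inP a_max] ne_ij ai0.
pose f k : nat := if k == i then (a i).-1 else if k == j then (a j).+1 else a k.
have f_sum : (\sum_(k < d) f k = e)%N.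
  move: aX; rewrite inE => /eqP <-.
  rewrite (bigD1 i) // (bigD1 j) 1?eq_sym //= [RHS](bigD1 i) //.
  rewrite [in RHS](bigD1 j) 1?eq_sym //= /f !eqxx eq_sym (negPf ne_ij).
  rewrite (eq_bigr (fun k => a k : nat)) => [|k /andP[/negPf -> /negPf -> //]].
  by rewrite !addnA addnS -addSn prednK.
have := a_max _ (to_exponent_composition f_sum).
rewrite !dotv_pow -subr_ge0 (sum_swap ne_ij) => [|k /negPf ki /negPf kj]; last first.
  by rewrite to_exponentE // /f ki kj.
rewrite !to_exponentE // /f !eqxx eq_sym (negPf ne_ij) -{1}(prednK ai0) !exprS.
have q1 := q_gt1 => H; have : 0 <= (q - 1) * (c 0 i * q ^+ (a i).-1 - c 0 j * q ^+ a j).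
  by move: H; lra.
by rewrite pmulr_rge0 ?subr_gt0 //; lra.
Qed.

Lemma argmax_neg (c : 'rV_d) : (0 < d)%N -> (forall j, c 0 j < 0) ->
  exists S b, bottom_face e S b != set0 /\ argmax_pow c = bottom_face e S b.
Proof.
move=> d0 c0; have X0 : X != set0.
  by apply/set0Pn; exists (corner e (Ordinal d0)); apply: corner_composition.
have [a aM] := argmax_nonempty pow_pt c X0.
have aX : a \in X by case/setIdP: aM.
have [i0 ai0] := composition_pos e_gt0 aX.
pose w j := - c 0 j; have w0 j : 0 < w j by rewrite oppr_gt0.
(* The threshold [t] is the largest weight one unit below a positive coordinate of the maximiser
   [a]; by exchange no [w j * q ^+ a j] falls below it. *)
case: (@arg_maxP _ _ _ i0 (fun i => (0 < a i)%N) (fun i => w i * q ^+ (a i).-1) ai0).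
move=> i ai t_max; set t := w i * q ^+ (a i).-1 in t_max.
have t_le j : t <= w j * q ^+ a j.
  have [<-|ne_ij] := eqVneq i j; last exact: argmax_exchange.
  by rewrite ler_pM2l // ler_weXn2l ?leq_pred // ltW.
(* This makes [b j] the least exponent at which coordinate [j] reaches [t]: the previous exponent is
   taken when it already attains [t]. *)
pose b j : nat := if (0 < a j)%N && (w j * q ^+ (a j).-1 == t) then (a j).-1 else a j.
pose S := [set j | w j * q ^+ b j == t].
have aL : a \in bottom_face e S b.
  apply/coordwiseP; split=> [|j]; first by move: aX; rewrite inE => /eqP.
  rewrite inE /b; case: ifP => [/andP[aj ->]|_]; last by rewrite eqxx.
  by rewrite prednK // eqxx orbT.
have L0 : bottom_face e S b != set0 by apply/set0Pn; exists a.
exists S, b; split=> //; apply: (@argmax_bottom c t) => // [j|j k lt_kb|j].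
- by rewrite -/(w j) /b; case: ifP => [/andP[_ /eqP ->]|_].
- rewrite -/(w j); move: lt_kb; rewrite /b; case: ifP => [/andP[aj /eqP <-]|].
    by move=> lt_k; rewrite ltr_pM2l // ltr_eXn2l.
  move=> + lt_k; have aj : (0 < a j)%N by apply: leq_ltn_trans lt_k.
  rewrite aj => /negbT /= ne_t; apply: (@le_lt_trans _ _ (w j * q ^+ (a j).-1)).
    by rewrite ler_pM2l // ler_weXn2l ?ltW // -ltnS prednK.
  by rewrite lt_neqAle ne_t; apply: t_max.
- by rewrite inE.
Qed.

(** The sign of the largest coefficient decides among chords, slope zero and tangents. *)
Lemma argmax_class (c : 'rV_d) : (0 < d)%N ->
  [\/ exists2 S, S != set0 & argmax_pow c = top_face e S,
      exists2 Z, Z != set0 & argmax_pow c = coord_face e Z |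
      exists S b, bottom_face e S b != set0 /\ argmax_pow c = bottom_face e S b].
Proof.
move=> d0; case: (arg_maxP (fun j => c 0 j) (erefl : predT (Ordinal d0))).
move=> i _ c_max; have {}c_max j : c 0 j <= c 0 i by apply: c_max.
have iS : [set j | c 0 j == c 0 i] != set0 by apply/set0Pn; exists i; rewrite inE.
have [ci_lt0|ci_gt0|ci0] := ltgtP (c 0 i) 0.
- by apply/Or33/argmax_neg => // j; apply: le_lt_trans ci_lt0.
- apply: Or31; exists [set j | c 0 j == c 0 i] => //.
  by apply: argmax_top ci_gt0 _ _ _ => // j; rewrite inE.
- apply: Or32; exists [set j | c 0 j == c 0 i] => //.
  by apply: argmax_coord => // j; [rewrite -ci0|rewrite inE ci0].
Qed.

(** * Dimensions of the three families *)

Lemma mul_pow_sub a a' (c : 'cV_d) : (pow_pt a - pow_pt a') *m c = 0 ->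
  \sum_k q ^+ a k * c k 0 = \sum_k q ^+ a' k * c k 0.
Proof.
move=> /matrixP/(_ 0 0); rewrite !mxE => H; apply/eqP; rewrite -subr_eq0 -sumrB.
by apply/eqP; rewrite -[RHS]H; apply: eq_bigr => k _; rewrite !mxE mulrBl.
Qed.

Lemma affdim_top S : S != set0 ->
  affdim (hull pow_pt (top_face e S)) #|S|.-1.
Proof.
case/set0Pn=> i0 i0S; have qe : 1 < q ^+ e by rewrite exprn_egt1 // -lt0n.
have cornerS i : i \in S -> corner e i \in top_face e S by rewrite corner_top.
apply: (@affdim_hull_weighted _ _ _ _ _ S i0 (fun=> 1) (corner e i0)) => //.
- exact: cornerS.
- by move=> i; rewrite oner_neq0.
- move=> a k /(top_faceP e_gt0)[i iS ->] kS; rewrite !mxE !cornerE.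
  have /negPf -> : k != i by apply: contraNneq kS => ->.
  by have /negPf -> : k != i0 by apply: contraNneq kS => ->.
- suff H i : i \in S -> \sum_(k in S) pow_pt (corner e i) 0 k / 1
      = \sum_(k in S) 1 + (q ^+ e - 1).
    by move=> a /(top_faceP e_gt0)[i iS ->]; rewrite !H.
  move=> iS; transitivity (\sum_(k in S) (1 + if k == i then q ^+ e - 1 else 0)).
    apply: eq_bigr => k _; rewrite mxE cornerE divr1.
    by case: eqP => _; rewrite ?expr0 ?addr0 // addrC subrK.
  rewrite big_split /=; congr (_ + _).
  by rewrite (bigD1 i) //= eqxx big1 ?addr0 // => k /andP[_ /negPf ->].
move=> c cM i iS; rewrite !mul1r; have [->//|ne_i] := eqVneq i i0.
have /eqP := mul_pow_sub (cM _ (cornerS i iS)); rewrite -subr_eq0.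
rewrite (sum_swap ne_i) => [|k /negPf ki /negPf ki0]; last by rewrite !cornerE ki ki0.
rewrite !cornerE !eqxx [i0 == i]eq_sym (negPf ne_i) => /eqP H.
have : (q ^+ e - 1) * (c i 0 - c i0 0) = 0 by rewrite -[RHS]H; ring.
by move/eqP; rewrite mulf_eq0 !subr_eq0 (gt_eqF qe) => /eqP.
Qed.

(** Dividing coordinate [k] by [q ^+ b k] leaves [q] on raised coordinates and 1 elsewhere. The
    number of raised ones is fixed, so the weighted sum over [S] is constant, and swaps show that
    there is no other relation. *)
Lemma affdim_bottom S b :
  (\sum_(j < d) b j < e < \sum_(j < d) b j + #|S|)%N ->
  affdim (hull pow_pt (bottom_face e S b)) #|S|.-1.
Proof.
move=> be; have [i0 i0S] : exists i, i \in S.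
  by apply/card_gt0P; apply: ltnW; apply: bottom_face_dim be.
have [a0 a0L _] := bottom_face_low be i0.
have qb k : q ^+ b k != 0 by rewrite expf_neq0 // gt_eqF.
apply: (@affdim_hull_weighted _ _ _ _ _ S i0 (fun i => q ^+ b i) a0) => //.
- have H a k : a \in bottom_face e S b -> k \notin S -> pow_pt a 0 k = q ^+ b k.
    move=> /coordwiseP[_ /(_ k)] + kS; rewrite (negPf kS) andbF orbF mxE.
    by move/eqP ->.
  by move=> a k aL kS; rewrite !H.
- suff H a : a \in bottom_face e S b -> \sum_(k in S) pow_pt a 0 k / q ^+ b k
      = \sum_(k in S) 1 + (e - \sum_(j < d) b j)%:R * (q - 1).
    by move=> a aL; rewrite !H.
  move=> aL; have [T sTS aT] := bottom_face_sum aL.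
  have -> : (e - \sum_(j < d) b j = #|T|)%N.
    have <- : (\sum_(j < d) (b j + (j \in T)) = e)%N.
      by case/coordwiseP: aL => ae _; rewrite -[RHS]ae; apply: eq_bigr.
    by rewrite sum_addn_mem addKn.
  transitivity (\sum_(k in S) (1 + if k \in T then q - 1 else 0)).
    apply: eq_bigr => k _; rewrite mxE aT exprD mulrAC divff // mul1r.
    by case: (k \in T); rewrite ?expr0 ?addr0 // addrC subrK.
  rewrite big_split /=; congr (_ + _).
  rewrite -big_mkcondr /= (eq_bigl (mem T)) => [|k].
    by rewrite sumr_const mulr_natl.
  by rewrite andb_idl //; apply: (subsetP sTS).
move=> c cM i iS; have [->//|ne_i] := eqVneq i i0.
have [a [a' [aL a'L aa']]] := bottom_face_swap ne_i iS i0S be.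
have /eqP : \sum_k q ^+ a k * c k 0 = \sum_k q ^+ a' k * c k 0.
  by rewrite (mul_pow_sub (cM _ aL)) (mul_pow_sub (cM _ a'L)).
have [_ [ai ai0]] := aa' i.
have a'i : a' i = b i :> nat.
  by have [] := aa' i; rewrite eqxx (negPf ne_i); lia.
have a'i0 : a' i0 = (b i0).+1 :> nat.
  by have [] := aa' i0; rewrite eqxx eq_sym (negPf ne_i); lia.
rewrite -subr_eq0 (sum_swap ne_i) => [|k /negPf ki /negPf ki0]; last first.
  by have [] := aa' k; rewrite ki ki0 !addn0 => ->.
rewrite ai ai0 a'i a'i0 !exprS => /eqP H.
have : (q - 1) * (q ^+ b i * c i 0 - q ^+ b i0 * c i0 0) = 0 by rewrite -[RHS]H; ring.
by move/eqP; rewrite mulf_eq0 !subr_eq0 (gt_eqF q_gt1) => /eqP.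
Qed.

(** Comparing the corner at [k] with the composition that gives one of its units to [l] yields
    [q ^+ e.-1 * c k 0 = c l 0] for any form constant on the face. *)
Lemma affdim_coord Z : (1 < #|Z|)%N ->
  affdim (hull pow_pt (coord_face e Z)) #|Z|.
Proof.
move=> Z1; have [i0 i0Z] : exists i, i \in Z by apply/card_gt0P; apply: ltnW.
have qe : 1 < q ^+ e.-1 by rewrite exprn_egt1 //; lia.
apply: (@affdim_hull_coord _ _ _ _ _ Z (corner e i0)).
- by rewrite corner_coord.
- have H a k : a \in coord_face e Z -> k \notin Z -> pow_pt a 0 k = 1.
    move=> /coordwiseP[_ /(_ k)] + kZ; rewrite (negPf kZ) orbF mxE.
    by move/eqP ->.
  by move=> a k aZ kZ; rewrite !H // corner_coord.
move=> c cM i iZ; have [j jZ ne_ji] := card_mem_neq i Z1.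
have key k l : k \in Z -> l \in Z -> k != l -> q ^+ e.-1 * c k 0 = c l 0.
  move=> kZ lZ ne_kl.
  pose f m : nat := if m == k then e.-1 else if m == l then 1%N else 0%N.
  have f_sum : (\sum_(m < d) f m = e)%N.
    rewrite (bigD1 k) // (bigD1 l) 1?eq_sym //= /f !eqxx eq_sym (negPf ne_kl).
    by rewrite big1 => [|m /andP[/negPf -> /negPf -> //]]; lia.
  have fZ : to_exponent e f \in coord_face e Z.
    apply/coordwiseP; split=> [|m].
      by under eq_bigr do rewrite to_exponentE //.
    rewrite to_exponentE // /f; case: (eqVneq m k) => [->|_]; first by rewrite kZ orbT.
    by case: (eqVneq m l) => [->|_]; rewrite ?lZ ?orbT.
  have kF : corner e k \in coord_face e Z by rewrite corner_coord.
  have /eqP : \sum_m q ^+ corner e k m * c m 0 = \sum_m q ^+ to_exponent e f m * c m 0.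
    by rewrite (mul_pow_sub (cM _ kF)) (mul_pow_sub (cM _ fZ)).
  rewrite -subr_eq0 (sum_swap ne_kl) => [|m /negPf mk /negPf ml]; last first.
    by rewrite cornerE to_exponentE // /f mk ml.
  rewrite !cornerE !to_exponentE // /f !eqxx [l == k]eq_sym (negPf ne_kl).
  rewrite -{1}(prednK e_gt0) exprS expr1 expr0 => /eqP H.
  have : (q - 1) * (q ^+ e.-1 * c k 0 - c l 0) = 0 by rewrite -[RHS]H; ring.
  by move/eqP; rewrite mulf_eq0 !subr_eq0 (gt_eqF q_gt1) => /eqP.
have ij := key _ _ iZ jZ; have ji := key _ _ jZ iZ ne_ji.
(* Applying the relation back and forth multiplies [c i 0] by a factor that differs from 1 because
   [e > 1], so the coefficient is zero. *)
have : (q ^+ e.-1 * q ^+ e.-1 - 1) * c i 0 = 0.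
  by rewrite mulrBl -mulrA ij 1?eq_sym // ji mul1r subrr.
move/eqP; rewrite mulf_eq0 subr_eq0 gt_eqF => [/eqP //|].
by rewrite -exprD exprn_egt1 //; lia.
Qed.

Lemma coord_face_set1 (i : 'I_d) : coord_face e [set i] = [set corner e i].
Proof.
apply/setP=> a; rewrite inE; apply/idP/eqP => [|->]; last by rewrite corner_coord ?set11.
case/coordwiseP=> ae aE; apply/ffunP=> j; apply/val_inj; rewrite /= cornerE.
have a0 k : k != i -> a k = 0%N :> nat.
  by move=> /negPf ki; move: (aE k); rewrite inE ki orbF => /eqP.
case: eqVneq => [->|/a0 //]; move: ae.
by rewrite (bigD1 i) //= big1 ?addn0.
Qed.

(** If [e] meets either bound, the face is a single point, of dimension 0. *)
Lemma affdim_bottom_extreme S b k : bottom_face e S b != set0 ->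
  (0 < k)%N -> affdim (hull pow_pt (bottom_face e S b)) k ->
  (\sum_(j < d) b j < e < \sum_(j < d) b j + #|S|)%N.
Proof.
case/set0Pn=> a aL k0 dimk; have /andP[le_be le_eb] := bottom_face_bounds aL.
rewrite !ltn_neqAle le_be le_eb !andbT -negb_or; apply/negP => ext.
suff dim0 : affdim (hull pow_pt (bottom_face e S b)) 0.
  by rewrite (affdim_uniq dimk dim0) in k0.
apply/(affdim_hull0 _ pow_pt_inj); exists a; apply/setP=> a'; rewrite inE.
apply/idP/eqP => [a'L|->//]; apply: bottom_face_extreme a'L aL.
by rewrite [(_ + _)%N == e]eq_sym.
Qed.

(** * Matching face sets with faces of each dimension *)

Lemma face_setsP k M : (0 < d)%N -> (0 < k)%N ->
  M \in face_sets d e k <->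
  (exists c, M = argmax_pow c) /\ affdim (hull pow_pt M) k.
Proof.
move=> d0 k0; split=> [|[[c ->] dimk]].
  case/setUP => [/setUP[]|] /imsetP.
  - case=> S; rewrite inE => /eqP cS ->.
    have S0 : S != set0 by rewrite -card_gt0 cS.
    split; first by have [c <-] := top_face_argmax S0; exists c.
    by have := affdim_top S0; rewrite cS.
  - case=> Z; rewrite inE => /andP[k1 /eqP cZ] ->.
    have Z0 : Z != set0 by rewrite -card_gt0 cZ.
    split; first by have [c <-] := coord_face_argmax Z0; exists c.
    by have := @affdim_coord Z; rewrite cZ; apply.
  - case=> -[S b] /=; rewrite !inE /= => /andP[/eqP cS bB] ->.
    have be : (\sum_(j < d) b j < e < \sum_(j < d) b j + #|S|)%N by rewrite cS.
    split; last by have := affdim_bottom be; rewrite cS.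
    have [a aL _] := bottom_face_low be (Ordinal d0).
    have [c <-] : exists c, argmax_pow c = bottom_face e S (fun j => b j).
      by apply: bottom_face_argmax; apply/set0Pn; exists a.
    by exists c.
have [[S S0 eqM]|[Z Z0 eqM]|[S [b [L0 eqM]]]] := argmax_class c d0;
  rewrite eqM in dimk *; rewrite !inE -?orbA.
- apply/or3P/Or31/imset_f; rewrite inE (affdim_uniq dimk (affdim_top S0)).
  by rewrite prednK ?card_gt0.
- have [Z1|] := ltnP 1 #|Z|.
    have eq_k := affdim_uniq dimk (affdim_coord Z1).
    by apply/or3P/Or32/imset_f; rewrite inE eq_k Z1 eqxx.
  rewrite leq_eqVlt ltnS leqn0 cards_eq0 (negPf Z0) orbF => /cards1P[i Zi].
  have dim0 : affdim (hull pow_pt (coord_face e Z)) 0.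
    by apply/(affdim_hull0 _ pow_pt_inj); exists (corner e i); rewrite Zi coord_face_set1.
  by rewrite (affdim_uniq dimk dim0) in k0.
have be := affdim_bottom_extreme L0 k0 dimk.
(* The base is re-encoded as an exponent; [inord] is faithful because each [b j] is at most the
   total, which is below [e]. *)
pose b' : exponent := [ffun j => inord (b j)].
have eq_b : (fun j => b' j : nat) = b.
  apply/funext => j; rewrite ffunE inordK // ltnS ltnW //.
  by case/andP: be => + _; apply: leq_ltn_trans; rewrite (bigD1 j) //= leq_addr.
have cS : #|S| = k.+1.
  rewrite (affdim_uniq dimk (affdim_bottom be)) prednK //.
  exact: ltnW (bottom_face_dim be).
apply/or3P/Or33/imsetP; exists (S, b'); last by rewrite /= eq_b.
rewrite !inE /= cS eqxx -[k.+1]cS; move: be; rewrite -eq_b.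
by [].
Qed.

Lemma num_pow_faces k : (0 < d)%N -> (0 < k)%N ->
  num_faces (hull pow_pt X) k #|face_sets d e k|.
Proof.
move=> d0 k0; apply: num_faces_hull => [|M]; last exact: face_setsP.
by apply/set0Pn; exists (corner e (Ordinal d0)); apply: corner_composition.
Qed.

(** Every composition is a vertex, being the bottom face based at itself with [S] empty. *)
Lemma num_pow_vertices : (0 < d)%N -> num_faces (hull pow_pt X) 0 #|X|.
Proof.
move=> d0; rewrite -(card_imset X set1_inj); apply: num_faces_hull => [|M].
  by apply/set0Pn; exists (corner e (Ordinal d0)); apply: corner_composition.
split=> [/imsetP[a aX ->]|[[c ->] /(affdim_hull0 _ pow_pt_inj)[a eqM]]].
  split; last by apply/(affdim_hull0 _ pow_pt_inj); exists a.
  have eqL : bottom_face e set0 (fun j => a j) = [set a].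
    apply/setP=> a'; rewrite inE; apply/coordwiseP/eqP => [[_ aE]|->].
      apply/ffunP=> j; apply/val_inj/eqP.
      by move: (aE j); rewrite inE andbF orbF.
    by split=> [|j]; [move: aX; rewrite inE => /eqP|rewrite eqxx].
  have [c <-] : exists c, argmax_pow c = [set a].
    by rewrite -eqL; apply: bottom_face_argmax; rewrite eqL -card_gt0 cards1.
  by exists c.
rewrite eqM; apply: imset_f.
have : a \in argmax_pow c by rewrite eqM set11.
by case/setIdP.
Qed.

End PowerPolytope.

(** * From factorisations to exponents, and the face numbers *)

Lemma vfact_pfactorP (R : realType) (p e d : nat) (x : 'rV[R]_d) : prime p ->
  vfact (p ^ e) x <->
  exists2 a, a \in composition d e & x = pow_pt (p%:R : R)%R a.
Proof.
move=> p_pr; split=> [[v [v_prod xv]]|[a aX ->]]; last first.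
  exists (fun j => p ^ a j); split; last by move=> j; rewrite mxE natrX.
  by rewrite -expn_sum; move: aX; rewrite inE => /eqP ->.
have /choice[f fP] i : exists n, v i = p ^ n.
  have /(dvdn_pfactor _ _ p_pr)[n _ ->] : v i %| p ^ e.
    by rewrite -v_prod (bigD1 i) //= dvdn_mulr.
  by exists n.
have f_sum : \sum_(i < d) f i = e.
  apply: (@expnI p (prime_gt1 p_pr)).
  by rewrite expn_sum -v_prod; apply: eq_bigr => i _; rewrite fP.
exists (to_exponent e f); first exact: to_exponent_composition.
by apply/rowP=> j; rewrite xv mxE to_exponentE // fP natrX.
Qed.

Lemma bin_succ_sub n m : 0 < m -> 'C(n.+1, m) - 'C(n, m) = 'C(n, m - 1).
Proof. by case: m => // m _; rewrite binS addKn subn1. Qed.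

Theorem theorem1p3 (R : realType) (p e d : nat) :
  prime p -> (2 <= e)%N -> (2 <= d)%N ->
  let P := conv_hull (@vfact R (p ^ e) d) in
  num_faces P 0 'C(e + d - 1, d - 1) /\
  num_faces P 1 ('C(d, 2) + 'C(d, 2) * 'C(e + d - 2, d - 1)) /\
  (forall k : nat, (2 <= k)%N -> (k < d)%N ->
     num_faces P k ('C(d.+1, k.+1) + 'C(d, k.+1) * 'C(e + d - 1, d)
                    - 'C(d, k.+1) * 'C(e + d - 1 - k, d))) /\
  num_faces P d 1.
Proof.
move=> p_pr e1 d1; have d0 := ltnW d1.
have q1 : (1 < p%:R :> R)%R by rewrite ltr1n prime_gt1.
have -> : conv_hull (@vfact R (p ^ e) d)
    = hull (pow_pt (p%:R : R)%R) (composition d e).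
  congr conv_hull; apply/funext => x; apply/propext; exact: vfact_pfactorP.
move=> P; have faces k : 0 < k -> num_faces P k ('C(d, k.+1)
    + (if 1 < k then 'C(d, k) else 0)
    + 'C(d, k.+1) * ('C(e + d - 1, d) - 'C(e + d - 1 - k, d))).
  by move=> k0; rewrite -card_face_sets //; apply: num_pow_faces.
split; first by rewrite -card_composition ?(ltnW e1) //; apply: num_pow_vertices.
split.
  (* For [k = 1] the coordinate family is empty, and the difference of binomials collapses by
     Pascal's rule. *)
  have := faces 1 isT; rewrite addn0; congr (num_faces P 1 (_ + _ * _)).
  have -> : e + d - 1 = (e + d - 2).+1 by lia.
  by rewrite subn1 /= bin_succ_sub.
split=> [k k1 kd|].
  have := faces k (ltnW k1); rewrite k1; congr (num_faces P k _).
  (* Pascal's rule merges the top and coordinate families; [addnBA] needs the remaining bound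
     because subtraction is truncated. *)
  rewrite mulnBr binS addnBA //.
  by rewrite leq_mul2l leq_bin2l ?orbT // leq_subr.
(* No set has [d.+1] indices, so only the coordinate face on all [d] indices remains: the polytope
   itself. *)
have := faces d d0; rewrite d1 binn bin_small //.
Qed.
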